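(* Let $(X,d)$ be a complete metric space, let $\eta\in\mathbb{N}$, and let $\mathcal{U}:\prod_{l=1}^{\infty}X\to X$ be a generalized $\mathcal{C}_\eta$ contraction. Then the following hold: (1) $\mathcal{U}$ has a unique fixed point, i.e. there exists a unique $w\in X$ such that $\mathcal{U}(w,w,w,\ldots)=w$. (2) For any $x_1,x_2,\ldots,x_\eta\in X$, the infinite $\eta$-Picard sequence starting from $x_1,\ldots,x_\eta$ converges to $w$.
   Context: $\mathbb{N}$ denotes the positive integers. For points $w_1,\ldots,w_\eta\in X$, write $(w_{i,\widehat{\eta}})_{i=1}^{\infty}=(w_1,w_2,\ldots,w_{\eta-1},w_\eta,w_\eta,w_\eta,\ldots)$ for the infinite tuple in which the $\eta$-th point is repeated forever. $\mathbb{G}_{1/2}$ is the set of functions $\beta:[0,\infty)\to[0,\tfrac12)$ such that for every sequence $(t_n)$ in $[0,\infty)$, $\lim_{n\to\infty}\beta(t_n)=\tfrac12$ implies $\lim_{n\to\infty}t_n=0$. For $\mathcal{U}:\prod_{l=1}^{\infty}X\to X$ and infinite tuples $\mathbf{w}=(w_i)_{i=1}^\infty$, $\mathbf{v}=(v_i)_{i=1}^\infty$ in $X$, put $B_\eta(\mathbf{w},\mathbf{v})=d(w_\eta,v_\eta)$, $K_\eta(\mathbf{w},\mathbf{v})=d(\mathcal{U}(\mathbf{w}),w_\eta)+d(\mathcal{U}(\mathbf{v}),v_\eta)$, $F_\eta(\mathbf{w},\mathbf{v})=d(\mathcal{U}(\mathbf{w}),v_\eta)+d(\mathcal{U}(\mathbf{v}),w_\eta)$,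 and, for fixed real numbers $\alpha,\gamma,\delta\ge 0$ with $\alpha+2\gamma+2\delta=1$, $\mathcal{M}'_{\mathcal{U}_\eta}(\mathbf{w},\mathbf{v})=\alpha B_\eta(\mathbf{w},\mathbf{v})+2\gamma K_\eta(\mathbf{w},\mathbf{v})+2\delta F_\eta(\mathbf{w},\mathbf{v})$. $\mathcal{U}$ is a generalized $\mathcal{C}_\eta$ contraction if, for some such $\alpha,\gamma,\delta$ and some $\beta\in\mathbb{G}_{1/2}$, for all $w_1,\ldots,w_\eta,v_1,\ldots,v_\eta\in X$, setting $\mathbf{w}=(w_{i,\widehat{\eta}})_{i=1}^\infty$ and $\mathbf{v}=(v_{i,\widehat{\eta}})_{i=1}^\infty$, $d(\mathcal{U}(\mathbf{w}),\mathcal{U}(\mathbf{v}))\le\beta\big(\mathcal{M}'_{\mathcal{U}_\eta}(\mathbf{w},\mathbf{v})\big)\,\mathcal{M}'_{\mathcal{U}_\eta}(\mathbf{w},\mathbf{v})$. The infinite $\eta$-Picard sequence starting from $x_1,\ldots,x_\eta\in X$ is defined by $x_{n+\eta}=\mathcal{U}(x_n,x_{n+1},\ldots,x_{n+\eta-1},x_{n+\eta-1},x_{n+\eta-1},\ldots)$ for all $n\in\mathbb{N}$. *)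

(* Defs.v *)
From HB Require Import structures.
From mathcomp Require Import all_boot all_order all_algebra.
From mathcomp Require Import all_classical all_reals all_analysis.

Set Implicit Arguments.
Unset Strict Implicit.
Unset Printing Implicit Defensive.

Import Order.TTheory GRing.Theory Num.Theory.
Import numFieldNormedType.Exports.

Local Open Scope classical_set_scope.
Local Open Scope ring_scope.

(* The library has metricType and completeType but not their join.
   completeType extends pointedType, so the carrier is nonempty (the empty
   space carries a contraction but no fixed point). *)
#[short(type="completeMetricType")]
HB.structure Definition CompleteMetric (R : realType) :=
  {T of Metric R T & Complete T}.

(* Infinite tuples (w_1, w_2, ...) are functions on nat with w_l stored at
   index l - 1; in particular w_eta is w eta.-1. *)

(* (w_1, ..., w_eta, w_eta, w_eta, ...); only the first eta entries of w
   are read, so quantifying over w amounts to quantifying over w_1..w_eta. *)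
Definition repeat_from {X : Type} (eta : nat) (w : nat -> X) : nat -> X :=
  fun i => w (minn i eta.-1).

(* The set G_{1/2}; only the values of beta on [0, +oo[ matter. *)
Definition geraghty_half {R : realType} (beta : R -> R) : Prop :=
  (forall t, 0 <= t -> 0 <= beta t < 2^-1) /\
  (forall t : nat -> R, (forall n, 0 <= t n) ->
     beta (t n) @[n --> \oo] --> (2^-1 : R) ->
     t n @[n --> \oo] --> (0 : R)).

Definition B_eta {R : realType} {X : metricType R} (eta : nat)
    (w v : nat -> X) : R :=
  mdist (w eta.-1) (v eta.-1).

Definition K_eta {R : realType} {X : metricType R} (U : (nat -> X) -> X)
    (eta : nat) (w v : nat -> X) : R :=
  mdist (U w) (w eta.-1) + mdist (U v) (v eta.-1).

Definition F_eta {R : realType} {X : metricType R} (U : (nat -> X) -> X)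
    (eta : nat) (w v : nat -> X) : R :=
  mdist (U w) (v eta.-1) + mdist (U v) (w eta.-1).

Definition M_eta {R : realType} {X : metricType R} (U : (nat -> X) -> X)
    (eta : nat) (alpha gamma delta : R) (w v : nat -> X) : R :=
  alpha * B_eta eta w v + 2 * gamma * K_eta U eta w v + 2 * delta * F_eta U eta w v.

Definition generalized_C_contraction {R : realType} {X : metricType R}
    (eta : nat) (U : (nat -> X) -> X) : Prop :=
  exists alpha gamma delta : R,
    [/\ 0 <= alpha, 0 <= gamma, 0 <= delta
      & alpha + 2 * gamma + 2 * delta = 1] /\
    exists2 beta : R -> R, geraghty_half beta &
      forall w v : nat -> X,
        let wh := repeat_from eta w in
        let vh := repeat_from eta v in
        let m := M_eta U eta alpha gamma delta wh vh in
        mdist (U wh) (U vh) <= beta m * m.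

(* x is the infinite eta-Picard sequence of U starting from the first eta
   entries of a; x_n is x n.-1. *)
Definition is_picard {X : Type} (eta : nat) (U : (nat -> X) -> X)
    (a x : nat -> X) : Prop :=
  (forall i, (i < eta)%N -> x i = a i) /\
  (forall n, x (n + eta)%N = U (repeat_from eta (fun i => x (n + i)%N))).

Lemma picard_exists (X : Type) (eta : nat) (U : (nat -> X) -> X)
    (a : nat -> X) : (0 < eta)%N -> exists x, is_picard eta U a x.
Proof.
move=> eta0.
pose next (s : nat -> X) i :=
  if (i < eta.-1)%N then s i.+1 else U (repeat_from eta s).
pose W n := iter n next a.
have WE i : forall n, (i < eta)%N -> W (n + i)%N 0 = W n i.
  elim: i => [|i IH] n ie; first by rewrite addn0.
  by rewrite addnS -addSn IH ?(ltnW ie)//= /next -ltnS prednK// ie.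
exists (fun n => W n 0%N); split=> [i ie|n]; first by rewrite -[i]add0n WE.
have -> : (n + eta)%N = (n.+1 + eta.-1)%N by rewrite addSnnS prednK.
rewrite WE ?prednK//= /next ltnn; congr U.
apply/funext => i; rewrite /repeat_from WE//.
by rewrite (leq_ltn_trans (geq_minr _ _))// prednK.
Qed.

(* Main.v *)
Require Import Defs.
From mathcomp Require Import all_boot all_order all_algebra.
From mathcomp Require Import all_classical all_reals all_analysis.
From mathcomp Require Import lra.
Import Order.TTheory GRing.Theory Num.Theory.
Import numFieldNormedType.Exports.
Local Open Scope classical_set_scope.
Local Open Scope ring_scope.

(** Only the last of the [eta] entries enters the contraction inequality, so
    along a Picard sequence it reads as a one-step condition on consecutive
    terms.  A function of [G_{1/2}] is bounded away from 1/2 on each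
    [[e, +oo[], and the weighted mean M is at most any common bound t of
    B, K and F; hence d(Uw, Uv) <= c t with c < 1/2 depending only on a lower
    bound of d(Uw, Uv).  Since 2 d(x, y) (up to consecutive distances) is such
    a bound t, the factor 2c < 1 forces the consecutive distances to 0, makes
    the sequence Cauchy, its limit fixed, and fixed points unique. *)

(** Otherwise there are t_n >= e with beta(t_n) > 1/2 - 1/(2(n+1)); then beta(t_n) tends to 1/2,
    which forces t_n to 0. *)
Lemma geraghty_half_gap {R : realType} {beta : R -> R} (e : R) :
  geraghty_half beta -> 0 < e ->
  exists2 c, 0 <= c < 2^-1 & forall t, e <= t -> beta t <= c.
Proof.
move=> [beta_bnd beta_cvg] e0; apply: contrapT => /forall2NP noc.
have ex n : exists t, e <= t /\ 2^-1 - 2^-1 * harmonic n < beta t.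
  have h1 : harmonic n <= 1 :> R by rewrite /harmonic invf_le1 ?ltr0n// ler1n.
  have h0 : 0 < harmonic n :> R by rewrite /harmonic invr_gt0 ltr0n.
  have [|/existsNP[t /not_implyP[et /negP]]] := noc (2^-1 - 2^-1 * harmonic n).
    by case; apply/andP; split; lra.
  by rewrite -ltNge; exists t.
have [t tP] := choice ex.
have t0 n : 0 <= t n by rewrite (le_trans (ltW e0)) ?(tP n).1.
have tcvg : t n @[n --> \oo] --> 0.
  apply: beta_cvg => //.
  apply: (@squeeze_cvgr _ _ _ _ (fun n => 2^-1 - 2^-1 * harmonic n)
    (fun=> 2^-1)).
  - apply: nearW => n; have /andP[_ /ltW ->] := beta_bnd _ (t0 n).
    by rewrite (ltW (tP n).2).
  - rewrite -[X in _ --> X]subr0; apply: cvgB; first exact: cvg_cst.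
    rewrite -[X in _ --> X](mulr0 2^-1); apply: cvgMl_tmp.
    exact: cvg_harmonic.
  - exact: cvg_cst.
have : e <= 0 by apply: cvgr_to_ge tcvg _; apply: nearW => n; exact: (tP n).1.
by rewrite leNgt e0.
Qed.

(* Stated for a relation: the image of a tuple is not determined by its last
   entry, see [last_step]. *)
Definition half_contractive {R : realType} {X : metricType R}
    (S : X -> X -> Prop) : Prop :=
  forall e : R, 0 < e -> exists2 c : R, 0 <= c < 2^-1 &
    forall a b p q t, S a p -> S b q ->
      mdist a b <= t -> mdist p a + mdist q b <= t ->
      mdist p b + mdist q a <= t ->
      e <= mdist p q -> mdist p q <= c * t.

Lemma convex_comb_le {R : realFieldType} (a b c x y z t : R) :
  0 <= a -> 0 <= b -> 0 <= c -> a + b + c = 1 ->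
  x <= t -> y <= t -> z <= t -> a * x + b * y + c * z <= t.
Proof.
move=> a0 b0 c0 abc xt yt zt; rewrite -[leRHS]mul1r -abc !mulrDl.
by rewrite !lerD// ler_wpM2l.
Qed.

Definition last_step {X : Type} (eta : nat) (U : (nat -> X) -> X) (a p : X) :=
  exists2 w, repeat_from eta w eta.-1 = a & U (repeat_from eta w) = p.

Lemma half_contractive_last_step {R : realType} {X : metricType R} {eta : nat}
    {U : (nat -> X) -> X} :
  generalized_C_contraction eta U -> half_contractive (last_step eta U).
Proof.
move=> [al [ga [de [[al0 ga0 de0 sum1] [beta betaG UC]]]]] e e0.
have [c c01 cP] := geraghty_half_gap e betaG e0.
exists c => // a b p q t [w wa wp] [v vb vq] Bt Kt Ft epq.
have := UC w v; cbv zeta.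
set m := M_eta _ _ _ _ _ _ _; rewrite wp vq => pqm.
have mt : m <= t.
  rewrite /m /M_eta /B_eta /K_eta /F_eta wa vb wp vq.
  by apply: convex_comb_le => //; exact: mulr_ge0.
have m0 : 0 <= m.
  rewrite /m /M_eta /B_eta /K_eta /F_eta.
  by rewrite !addr_ge0// ?mulr_ge0// ?addr_ge0// mdist_ge0.
have /andP[b0 b2] := betaG.1 _ m0.
(* Since d(p, q) <= m/2, a lower bound on d(p, q) is one on m, where the gap of [beta] is needed. *)
have em : e <= m.
  have : beta m * m <= 2^-1 * m by rewrite ler_wpM2r// ltW.
  lra.
case/andP: c01 => c0 _.
rewrite (le_trans pqm)// (le_trans (ler_wpM2r m0 (cP _ em)))//.
exact: ler_wpM2l.
Qed.

Section half_contractive_theory.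
Context {R : realType} {X : metricType R} {S : X -> X -> Prop}.
Hypothesis SC : half_contractive S.

(** Taking e = d(p, q) gives a factor that depends on p and q but is below 1/2; the weaker factor
    1/2 requires no lower bound on d(p, q). *)
Lemma half_contractive_le a b p q t : S a p -> S b q ->
  mdist a b <= t -> mdist p a + mdist q b <= t -> mdist p b + mdist q a <= t ->
  mdist p q <= t / 2.
Proof.
move=> ap bq Bt Kt Ft; have t0 : 0 <= t := le_trans (mdist_ge0 _ _) Bt.
have [->|pq] := eqVneq p q; first by rewrite mdistxx divr_ge0.
have [c /andP[_ c2] cP] := SC (mdist p q) ltac:(by rewrite mdist_gt0).
rewrite (le_trans (cP _ _ _ _ _ ap bq Bt Kt Ft (lexx _)))// mulrC.
by rewrite ler_wpM2l// ltW.
Qed.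

Lemma half_contractive_fixed_unique z w : S z z -> S w w -> z = w.
Proof.
move=> zz ww; apply/eqP/negPn/negP => zw.
have D0 : 0 < mdist z w by rewrite mdist_gt0.
have [c /andP[c0 c2] cP] := SC _ D0.
(* Here K vanishes and F is 2 d(z, w), so d(z, w) <= 2c d(z, w) with 2c < 1. *)
have := cP _ _ _ _ (2 * mdist z w) zz ww.
rewrite !mdistxx (metric_sym w z) => H.
have : mdist z w <= c * (2 * mdist z w) by apply: H => //; lra.
nra.
Qed.

Lemma half_contractive_step_cvg0 (y : nat -> X) :
  (forall n, S (y n) (y n.+1)) ->
  mdist (y n) (y n.+1) @[n --> \oo] --> (0 : R).
Proof.
move=> yS; set d := fun n => _.
have F n : mdist (y n.+1) (y n.+1) + mdist (y n.+2) (y n) <= d n + d n.+1.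
  by rewrite mdistxx add0r metric_sym metric_triangle.
have K n : mdist (y n.+1) (y n) + mdist (y n.+2) (y n.+1) <= d n + d n.+1.
  by rewrite (metric_sym (y n.+1) (y n)) (metric_sym (y n.+2)) lexx.
have B n : mdist (y n) (y n.+1) <= d n + d n.+1 by rewrite lerDl mdist_ge0.
(* The factor 1/2 gives d_(n+1) <= (d_n + d_(n+1))/2. *)
have d_noninc : nonincreasing_seq d.
  apply/nonincreasing_seqP => n.
  have := half_contractive_le _ _ _ _ _ (yS n) (yS n.+1) (B n) (K n) (F n).
  by rewrite -/(d n.+1); lra.
have dcvg : cvgn d.
  apply: nonincreasing_is_cvgn => //.
  by exists 0 => _ [n _ <-]; exact: mdist_ge0.
set r := limn d in dcvg *.
have rd n : r <= d n by exact: nonincreasing_cvgn_ge.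
have r0 : 0 <= r by apply: limr_ge => //; apply: nearW => n; exact: mdist_ge0.
suff -> : 0 = r by [].
apply/eqP; rewrite eq_sym; apply/negPn/negP => rn0.
have rpos : 0 < r by rewrite lt_neqAle eq_sym rn0.
have [c /andP[c0 c2] cP] := SC _ rpos.
have dScvg : d n.+1 @[n --> \oo] --> r by rewrite cvg_shiftS.
(* All d_n are at least r, so one c serves for every n and the inequality passes to the limit; it
   contradicts 2c < 1. *)
have : r <= c * (r + r).
  apply: (@ler_cvg_to _ \oo _ _ (fun n => d n.+1)
    (fun n => c * (d n + d n.+1))).
  - exact: dScvg.
  - apply: cvgMl_tmp; apply: cvgD; [exact: dcvg|exact: dScvg].
  - by apply: nearW => n; exact: cP _ _ _ _ _ (yS n) (yS n.+1) _ _ _ (rd n.+1).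
nra.
Qed.

Lemma half_contractive_cauchy (y : nat -> X) :
  (forall n, S (y n) (y n.+1)) -> cauchy (y n @[n --> \oo]).
Proof.
move=> yS; apply/cauchy_ballP => e e0.
have [c /andP[c0 c2] cP] := SC _ (divr_gt0 e0 (ltr0Sn _ 1)).
(* Steps shorter than s <= e/4 turn d(y_k, y_l) >= e into d(y_(k+1), y_(l+1)) >= e/2, the bound for
   which c was taken. *)
set s := e * (1 - 2 * c) / 4.
have s0 : 0 < s by rewrite /s; nra.
have se : s <= e / 4 by rewrite /s; nra.
have /cvgrPdist_lt/(_ _ s0)[N _ Ns] := half_contractive_step_cvg0 _ yS.
have dN n : (N <= n)%N -> mdist (y n) (y n.+1) < s.
  by move/Ns; rewrite /= sub0r normrN ger0_norm ?mdist_ge0.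
rewrite near_map2; near=> k l.
have dk : mdist (y k) (y k.+1) < s by apply: dN; near: k; exists N.
have dl : mdist (y l) (y l.+1) < s by apply: dN; near: l; exists N.
rewrite ballEmdist/= ltNge; apply/negP => eD.
have t1 := metric_triangle (y k) (y k.+1) (y l).
have t2 := metric_triangle (y k.+1) (y l.+1) (y l).
have t3 := metric_triangle (y k.+1) (y k) (y l).
have t4 := metric_triangle (y l.+1) (y l) (y k).
rewrite (metric_sym (y l.+1) (y l)) (metric_sym (y l) (y k)) in t2 t4.
rewrite (metric_sym (y k.+1) (y k)) in t3.
have := cP _ _ _ _ (2 * mdist (y k) (y l) + 2 * s) (yS k) (yS l).
rewrite (metric_sym (y k.+1) (y k)) (metric_sym (y l.+1) (y l)) => H.
have : mdist (y k.+1) (y l.+1) <= c * (2 * mdist (y k) (y l) + 2 * s).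
  by apply: H; lra.
set D := mdist (y k) (y l) in eD t1 t2 t3 t4 * => {}H.
(* From D <= d(y_(k+1), y_(l+1)) + 2s. The right side is below 3s, whereas D >= e makes the left
   side at least 4s. *)
have Ds : D * (1 - 2 * c) <= 2 * s + 2 * c * s by lra.
have : e * (1 - 2 * c) <= D * (1 - 2 * c) by rewrite ler_wpM2r//; lra.
have -> : e * (1 - 2 * c) = 4 * s by rewrite /s; lra.
nra.
Unshelve. all: by end_near. Qed.

Lemma half_contractive_lim_fixed (y : nat -> X) w p :
  (forall n, S (y n) (y n.+1)) -> y n @[n --> \oo] --> w -> S w p -> p = w.
Proof.
move=> yS yw wp; apply: mdist_positivity; apply/eqP; rewrite eq_le mdist_ge0.
rewrite andbT; apply/ler_addgt0Pl => e e0; rewrite addr0.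
have e5 : 0 < e / 5 by rewrite divr_gt0.
have /metricType_numDomainType.cvgrPdist_lt/(_ _ e5)[N _ Ns] := yw.
have d1 := Ns N (leqnn N); have d2 := Ns N.+1 (leqnSn N).
rewrite /= in d1 d2.
have t1 := metric_triangle p w (y N).
have t2 := metric_triangle (y N.+1) w (y N).
have t3 := metric_triangle p (y N.+1) w.
(* Halving this bound and adding d(y_(N+1), w) < e/5 yields d(p, w) <= d(p, w)/2 + 2e/5, hence d(p,
   w) <= 4e/5. *)
have := half_contractive_le _ _ _ _ (mdist p w + 2 * (e / 5)) wp (yS N).
rewrite (metric_sym (y N.+1) w) in t2 t3 * => H.
have : mdist p (y N.+1) <= (mdist p w + 2 * (e / 5)) / 2.
  have p0 := mdist_ge0 p w.
  by apply: H; lra.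
lra.
Qed.

End half_contractive_theory.

(** The window starting at index n ends at n + eta - 1 and its image sits at the next index, so the
    shift by eta - 1 leaves a one-step iteration. *)
Lemma is_picard_last_step {X : Type} {eta : nat} {U : (nat -> X) -> X}
    {a x : nat -> X} : (0 < eta)%N -> is_picard eta U a x ->
  forall n, last_step eta U (x (n + eta.-1)%N) (x (n.+1 + eta.-1)%N).
Proof.
move=> eta0 [_ xU] n; exists (fun i => x (n + i)%N).
  by rewrite /repeat_from minnn.
by rewrite -xU addSnnS prednK.
Qed.

Theorem theorem2p30 (R : realType) (X : completeMetricType R) (eta : nat)
    (U : (nat -> X) -> X) :
  (0 < eta)%N ->
  generalized_C_contraction eta U ->
  exists w : X,
    unique (fun z : X => U (fun=> z) = z) w /\
    (forall a x : nat -> X, is_picard eta U a x -> x n @[n --> \oo] --> w).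
Proof.
move=> eta0 UC; have SC := half_contractive_last_step UC.
(* A constant tuple is unchanged by [repeat_from]. *)
have const_step z : last_step eta U z (U (fun=> z)) by exists (fun=> z).
have fix_unique z w : U (fun=> z) = z -> U (fun=> w) = w -> z = w.
  move=> zz ww; apply: (half_contractive_fixed_unique SC).
    by rewrite -[X in last_step _ _ _ X]zz.
  by rewrite -[X in last_step _ _ _ X]ww.
have picard_cvg a x : is_picard eta U a x ->
    exists2 w, U (fun=> w) = w & x n @[n --> \oo] --> w.
  move=> /(is_picard_last_step eta0) xS.
  have /cauchy_cvg/cvg_ex[w xw] := half_contractive_cauchy SC _ xS.
  exists w.
    exact: half_contractive_lim_fixed SC _ _ _ xS xw (const_step w).
  by rewrite -(cvg_shiftn eta.-1).
(* Any starting tuple would do: the limit is a fixed point, and uniqueness identifies the limits of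
   all Picard sequences. *)
have [x0 x0P] := @picard_exists X eta U (fun=> point) eta0.
have [w wfix _] := picard_cvg _ _ x0P.
exists w; split; first by split=> // z; exact: fix_unique.
by move=> a x /picard_cvg[z zfix]; rewrite (fix_unique w z).
Qed.
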